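(* Let $n\ge2$, let $D\subsetneq\mathbb{R}^n$ be a domain, $x\in D$, and $t>0$ with $1-t\delta_D(x)>0$. Then $$B_j(x,r)\subset B_c(x,t)\subset B_j(x,R),$$ where $$r=\log\left(1+\frac{t\delta_D(x)}{1+t\delta_D(x)}\right)\qquad\text{and}\qquad R=\frac{t\delta_D(x)}{1-t\delta_D(x)}.$$ Moreover, $R/r\to1$ as $t\to0$.
   Context: $|\cdot|$ is the Euclidean norm and $\delta_D(x)=\mathrm{dist}(x,\partial D)$ is the Euclidean distance from $x$ to $\partial D$. The Cassinian metric on a domain $D\subsetneq\mathbb{R}^n$ is $$c_D(x,y)=\sup_{p\in\partial D}\frac{|x-y|}{|x-p||p-y|},\qquad x,y\in D,$$ the supremum being over the finite boundary points of $D$ (the point $\infty$, if it is a boundary point in $\overline{\mathbb{R}^n}$, contributes $0$). The distance ratio metric is $$j_D(x,y)=\log\left(1+\frac{|x-y|}{\min\{\delta_D(x),\delta_D(y)\}}\right).$$ The balls are $B_c(x,t)=\{y\in D:c_D(x,y)<t\}$ and $B_j(x,r)=\{y\in D:j_D(x,y)<r\}$. *)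

(* Defs.v *)
From HB Require Import structures.
From mathcomp Require Import all_boot all_order all_algebra.
From mathcomp Require Import all_classical all_reals all_analysis.

Set Implicit Arguments.
Unset Strict Implicit.
Unset Printing Implicit Defensive.

Import Order.TTheory GRing.Theory Num.Theory.
Import numFieldNormedType.Exports.

Local Open Scope classical_set_scope.
Local Open Scope ring_scope.

(* The norm [`| x |] of the library on ['rV[R]_n] is the max norm, hence a
   separate Euclidean norm.  Both induce the canonical topology of ['rV[R]_n],
   which is the one used by [open], [connected], [closure] and [interior]. *)
Definition enorm (R : realType) (n : nat) (x : 'rV[R]_n) : R :=
  Num.sqrt (\sum_(i < n) x ord0 i ^+ 2).

Definition domain (R : realType) (n : nat) (D : set 'rV[R]_n) : Prop :=
  [/\ D !=set0, open D & connected D].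

(* Only the finite boundary points. *)
Definition boundary (R : realType) (n : nat) (D : set 'rV[R]_n)
    : set 'rV[R]_n :=
  closure D `\` interior D.

Definition bdist (R : realType) (n : nat) (D : set 'rV[R]_n) (x : 'rV[R]_n)
    : R :=
  inf [set enorm (x - p) | p in boundary D].

(* For a domain [D] other than the whole space and [x], [y] in [D], the
   boundary is nonempty and each quotient is at most
   [enorm (x - y) / (bdist D x * bdist D y)], so that the real-valued [sup] is
   the actual least upper bound. *)
Definition cassinian (R : realType) (n : nat) (D : set 'rV[R]_n)
    (x y : 'rV[R]_n) : R :=
  sup [set enorm (x - y) / (enorm (x - p) * enorm (p - y)) | p in boundary D].

Definition distance_ratio (R : realType) (n : nat) (D : set 'rV[R]_n)
    (x y : 'rV[R]_n) : R :=
  ln (1 + enorm (x - y) / Num.min (bdist D x) (bdist D y)).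

Definition cassinian_ball (R : realType) (n : nat) (D : set 'rV[R]_n)
    (x : 'rV[R]_n) (t : R) : set 'rV[R]_n :=
  [set y | D y /\ cassinian D x y < t].

Definition distance_ratio_ball (R : realType) (n : nat) (D : set 'rV[R]_n)
    (x : 'rV[R]_n) (r : R) : set 'rV[R]_n :=
  [set y | D y /\ distance_ratio D x y < r].

(* Main.v *)
Require Import Defs.
From HB Require Import structures.
From mathcomp Require Import all_boot all_order all_algebra.
From mathcomp Require Import all_classical all_reals all_analysis.
From mathcomp Require Import ring lra.

Import Order.TTheory GRing.Theory Num.Theory.
Import numFieldNormedType.Exports.

Local Open Scope classical_set_scope.
Local Open Scope ring_scope.

(** Write [d] and [e] for the distances of [x] and [y] to the boundary, [s] for
    [|x - y|] and [c] for the Cassinian distance of [x] and [y].  Everything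
    follows from comparing [c] with [s] in two ways.

    Upper bound ([cassinian_le]): each boundary point is at distance at least
    [d] from [x] and at least [e] from [y], so [c <= s / (d * e)].  With
    [d * e = min d e * max d e] and [d <= max d e], a bound on the quotient
    [s / min d e], which is what the distance ratio metric sees, becomes a bound
    on [c].  This gives the inner inclusion.

    Lower bound ([enorm_le_cassinian]): if [p] is a boundary point nearest to
    [x], then [|p - y| <= d + s], so [s <= c * d * (d + s)].  By the symmetry of
    [c], the same holds with [e] in place of [d], hence with [min d e].  Solving
    for [s / min d e] when [c < t] bounds it by [t * d / (1 - t * d)]
    ([ratio_le_of_quadratic]), and [ln (1 + v) < v] for [v > 0] turns this into
    the outer inclusion.

    Both need [d, e > 0] and a nonempty boundary.  The latter is the
    connectedness of lines: a line from a point of [D] to a point outside it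
    cannot be split by a clopen set.

    For the limit put [u = t * d]; the bounds [v / (1 + v) <= ln (1 + v) <= v]
    at [v = u / (1 + u)] squeeze the ratio of the radii between
    [(1 + u) / (1 - u)] and [(1 + 2 * u) / (1 - u)]
    ([radius_ratio_bounds]). *)

(** * The Euclidean norm *)

(** With [A], [B], [C] the sums of [a i ^+ 2], [b i ^+ 2], [a i * b i], the sum
    of the squares [(a i * B - b i * C) ^+ 2] is [B * (A * B - C ^+ 2)]; it is
    nonnegative, and [B] can be cancelled unless all [b i] vanish. *)
Lemma sum_cauchy_schwarz (R : realFieldType) (n : nat) (a b : 'I_n -> R) :
  (\sum_i a i * b i) ^+ 2 <= (\sum_i a i ^+ 2) * (\sum_i b i ^+ 2).
Proof.
set B := \sum_i b i ^+ 2; set C := \sum_i a i * b i.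
set A := \sum_i a i ^+ 2.
have B_ge0 : 0 <= B by apply: sumr_ge0 => i _; exact: sqr_ge0.
have [B0|B_neq0] := eqVneq B 0.
  have b0 i : b i = 0.
    have /allP/(_ i) : all (fun i => true ==> (b i ^+ 2 == 0)) (index_enum 'I_n).
      by rewrite -psumr_eq0 ?[X in X == 0]B0// => j _; exact: sqr_ge0.
    by rewrite mem_index_enum sqrf_eq0 => /(_ isT)/eqP.
  by rewrite /C big1 ?B0 ?mulr0 ?expr0n// => i _; rewrite b0 mulr0.
have B_gt0 : 0 < B by rewrite lt_neqAle eq_sym B_neq0.
have expand : \sum_i (a i * B - b i * C) ^+ 2 = B * (A * B - C ^+ 2).
  transitivity (\sum_i (B ^+ 2 * a i ^+ 2 +
                        (- 2 * B * C * (a i * b i) + C ^+ 2 * b i ^+ 2))).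
    by apply: eq_bigr => i _; ring.
  by rewrite !big_split/= -!mulr_sumr -/A -/B -/C; ring.
have : 0 <= B * (A * B - C ^+ 2).
  by rewrite -expand; apply: sumr_ge0 => i _; exact: sqr_ge0.
by rewrite pmulr_rge0// subr_ge0.
Qed.

Lemma enorm_ge0 (R : realType) (n : nat) (u : 'rV[R]_n) : 0 <= enorm u.
Proof. exact: sqrtr_ge0. Qed.

Lemma enormN (R : realType) (n : nat) (u : 'rV[R]_n) : enorm (- u) = enorm u.
Proof. by congr Num.sqrt; apply: eq_bigr => i _; rewrite mxE sqrrN. Qed.

Lemma enormB (R : realType) (n : nat) (u v : 'rV[R]_n) :
  enorm (u - v) = enorm (v - u).
Proof. by rewrite -enormN opprB. Qed.

Lemma enorm_sqr (R : realType) (n : nat) (u : 'rV[R]_n) :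
  enorm u ^+ 2 = \sum_i u ord0 i ^+ 2.
Proof. by rewrite sqr_sqrtr// sumr_ge0// => i _; exact: sqr_ge0. Qed.

Lemma enormD (R : realType) (n : nat) (u v : 'rV[R]_n) :
  enorm (u + v) <= enorm u + enorm v.
Proof.
rewrite -(@ler_pXn2r _ 2)// ?nnegrE ?addr_ge0 ?enorm_ge0//.
rewrite sqrrD !enorm_sqr.
have -> : \sum_i (u + v) ord0 i ^+ 2 = \sum_i u ord0 i ^+ 2 +
    (\sum_i u ord0 i * v ord0 i) *+ 2 + \sum_i v ord0 i ^+ 2.
  rewrite -sumrMnl -!big_split/=.
  by apply: eq_bigr => i _; rewrite mxE sqrrD.
rewrite lerD2r lerD2l lerMn2r/= (le_trans (ler_norm _))//.
rewrite -(@ler_pXn2r _ 2)// ?nnegrE ?mulr_ge0 ?enorm_ge0//.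
by rewrite real_normK ?num_real// exprMn !enorm_sqr sum_cauchy_schwarz.
Qed.

(** The topology is that of the max norm; this comparison shows that a ball for
    it inside [D] keeps the boundary away in the Euclidean sense too. *)
Lemma mx_norm_le_enorm (R : realType) (n : nat) (u : 'rV[R]_n) :
  `|u| <= enorm u.
Proof.
rewrite -[`|u|]/(mx_norm u) mx_normrE.
apply/bigmax_leP; split=> [|[i j] _ /=]; first exact: enorm_ge0.
rewrite -(@ler_pXn2r _ 2)// ?nnegrE ?enorm_ge0// real_normK ?num_real//.
rewrite enorm_sqr (bigD1 j)//= ord1 lerDl sumr_ge0// => k _.
exact: sqr_ge0.
Qed.

(** * Distance to the boundary *)

(** If the boundary is empty then [D] is clopen, so its preimage under an affine
    line through a point of [D] and a point outside [D] disconnects [R]. *)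
Lemma boundary_nonempty (R : realType) (n : nat) (D : set 'rV[R]_n) :
  open D -> D !=set0 -> D `<` setT -> boundary D !=set0.
Proof.
move=> openD [x Dx] [_ notT].
have [//|/set0P/negP/negPn/eqP bd0] := pselect (boundary D !=set0).
have clD : closed D.
  rewrite closure_id; apply/seteqP; split; first exact: subset_closure.
  move=> z Dz; apply: contrapT => nDz.
  suff : boundary D z by rewrite bd0.
  by split=> // /interior_subset.
exfalso; apply: notT => z _; apply: contrapT => nDz.
pose f (t : R) : 'rV[R]_n := x + t *: (z - x).
have cf : continuous f.
  by move=> t; apply: cvgD; [exact: cvg_cst|apply: cvgZr_tmp; exact: cvg_id].
have /clopen_separatedP sep : clopen (f @^-1` D) by apply: preimage_clopen.
have conn : connected [set: R] by apply/connected_intervalP.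
have cover : [set: R] `<=` (f @^-1` D) `|` (~` (f @^-1` D)).
  by rewrite setUv.
have [/(_ 1 I)|/(_ 0 I)] := connected_subset sep cover conn.
- by rewrite /= /f scale1r addrC subrK.
- by rewrite /= /f scale0r addr0.
Qed.

Lemma bdist_le (R : realType) (n : nat) (D : set 'rV[R]_n) (x p : 'rV[R]_n) :
  boundary D p -> bdist D x <= enorm (x - p).
Proof.
move=> bp; apply: ge_inf; last by exists p.
by exists 0 => _ [q _ <-]; exact: enorm_ge0.
Qed.

(** An infimum over the empty set is [0], hence properness of [D] matters: it
    makes the boundary nonempty. *)
Lemma bdist_gt0 (R : realType) (n : nat) (D : set 'rV[R]_n) (x : 'rV[R]_n) :
  open D -> D `<` setT -> D x -> 0 < bdist D x.
Proof.
move=> openD Dproper Dx.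
have [e /= e_gt0 ballD] : nbhs_ball x D.
  by apply/nbhs_ballP; exact: open_nbhs_nbhs.
apply: (lt_le_trans e_gt0); apply: lb_le_inf.
  have [p bp] := boundary_nonempty _ _ _ openD (ex_intro _ x Dx) Dproper.
  by exists (enorm (x - p)), p.
move=> _ [p [_ nDp] <-]; rewrite leNgt; apply/negP => lt_e; apply: nDp.
rewrite (interior_id D).1//; apply: ballD.
rewrite -ball_normE /ball_ /=.
apply: le_lt_trans lt_e; exact: mx_norm_le_enorm.
Qed.

(** * Bounds for the Cassinian metric *)

(** Symmetry lets the estimate at the base point [x] be reused at [y]. *)
Lemma cassinianC (R : realType) (n : nat) (D : set 'rV[R]_n) (x y : 'rV[R]_n) :
  cassinian D x y = cassinian D y x.
Proof.
congr sup; apply/seteqP; split=> _ [p bp <-]; exists p => //;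
  by rewrite enormB (enormB _ _ p) (enormB _ _ _ p) [X in _ / X]mulrC.
Qed.

(** Besides the upper bound for the supremum, this provides the boundedness that
    makes the real-valued [sup] dominate each of its quotients. *)
Lemma cassinian_quotient_le (R : realType) (n : nat) (D : set 'rV[R]_n)
    (x y p : 'rV[R]_n) :
  0 < bdist D x -> 0 < bdist D y -> boundary D p ->
  enorm (x - y) / (enorm (x - p) * enorm (p - y)) <=
  enorm (x - y) / (bdist D x * bdist D y).
Proof.
move=> dx dy bp.
have dxp := bdist_le _ _ _ x _ bp.
have dyp := bdist_le _ _ _ y _ bp; rewrite enormB in dyp.
apply: ler_wpM2l; first exact: enorm_ge0.
have xp_gt0 : 0 < enorm (x - p) := lt_le_trans dx dxp.
have py_gt0 : 0 < enorm (p - y) := lt_le_trans dy dyp.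
by rewrite lef_pV2 ?posrE ?mulr_gt0// ler_pM// ltW.
Qed.

Lemma cassinian_le (R : realType) (n : nat) (D : set 'rV[R]_n)
    (x y : 'rV[R]_n) :
  boundary D !=set0 -> 0 < bdist D x -> 0 < bdist D y ->
  cassinian D x y <= enorm (x - y) / (bdist D x * bdist D y).
Proof.
move=> [p bp] dx dy; apply: ge_sup.
  by exists (enorm (x - y) / (enorm (x - p) * enorm (p - y))), p.
by move=> _ [q bq <-]; exact: cassinian_quotient_le.
Qed.

Lemma cassinian_ge (R : realType) (n : nat) (D : set 'rV[R]_n)
    (x y p : 'rV[R]_n) :
  0 < bdist D x -> 0 < bdist D y -> boundary D p ->
  enorm (x - y) / (enorm (x - p) * enorm (p - y)) <= cassinian D x y.
Proof.
move=> dx dy bp; apply: ub_le_sup; last by exists p.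
exists (enorm (x - y) / (bdist D x * bdist D y)) => _ [q bq <-].
exact: cassinian_quotient_le.
Qed.

(** For a boundary point [p] at distance [a] from [x], the triangle inequality
    [|p - y| <= a + |x - y|] gives the claim with [a] in place of [bdist D x];
    since the right-hand side is continuous in [a], one may pass to the infimum
    without knowing that it is attained. *)
Lemma enorm_le_cassinian (R : realType) (n : nat) (D : set 'rV[R]_n)
    (x y : 'rV[R]_n) :
  boundary D !=set0 -> 0 < bdist D x -> 0 < bdist D y ->
  enorm (x - y) <=
    cassinian D x y * bdist D x * (bdist D x + enorm (x - y)).
Proof.
move=> [p0 bp0] dx dy; set s := enorm (x - y); set c := cassinian D x y.
set d := bdist D x.
have s_ge0 : 0 <= s := enorm_ge0 _ _ _.
have c_ge0 : 0 <= c.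
  apply: le_trans (cassinian_ge _ _ _ _ _ _ dx dy bp0).
  by rewrite divr_ge0 ?mulr_ge0 ?enorm_ge0.
have quad p : boundary D p -> s <= c * enorm (x - p) * (enorm (x - p) + s).
  move=> bp; have dxp := bdist_le _ _ _ x _ bp.
  have dyp := bdist_le _ _ _ y _ bp; rewrite enormB in dyp.
  have xp_gt0 : 0 < enorm (x - p) := lt_le_trans dx dxp.
  have py_gt0 : 0 < enorm (p - y) := lt_le_trans dy dyp.
  have := cassinian_ge _ _ _ _ _ _ dx dy bp.
  rewrite -/s -/c ler_pdivrMr ?mulr_gt0// mulrA => /le_trans; apply.
  apply: ler_wpM2l; first by rewrite mulr_ge0 ?enorm_ge0.
  have -> : p - y = (p - x) + (x - y) by rewrite addrA subrK.
  by rewrite (le_trans (enormD _ _ _ _))// (enormB _ _ p x).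
apply/ler_addgt0Pr => e e_gt0.
(* [K] and [h] are such that the bound in [quad] grows by at most [e] when [enorm (x - p)]
   exceeds [d] by at most [h]; the condition [h <= 1] absorbs the term [h ^+ 2]
   of the expansion. *)
pose K := c * (2 * d + s + 1) + 1.
have K_gt0 : 0 < K by rewrite ltr_wpDl// mulr_ge0// !addr_ge0// mulr_ge0// ltW.
pose h := Num.min 1 (e / K).
have h_gt0 : 0 < h by rewrite lt_min ltr01 divr_gt0.
have hinf : has_inf [set enorm (x - p) | p in boundary D].
  split; first by exists (enorm (x - p0)), p0.
  by exists 0 => _ [q _ <-]; exact: enorm_ge0.
have [_ [p bp <-]] := inf_adherent h_gt0 hinf.
rewrite -/(bdist D x) -/d => lt_dh.
have h_le1 : h <= 1 by rewrite ge_min lexx.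
have hK_le : h * K <= e by rewrite -ler_pdivlMr// ge_min lexx orbT.
apply: (le_trans (quad p bp)); set a := enorm (x - p) in lt_dh *.
have a_ge0 : 0 <= a := enorm_ge0 _ _ _.
have : c * (a * (a + s)) <= c * ((d + h) * (d + h + s)).
  by apply: ler_wpM2l => //; apply: ler_pM; rewrite ?addr_ge0// ?lerD2r// ltW.
have : c * (h * h) <= c * (h * 1) by rewrite !ler_wpM2l// ltW.
rewrite /K in hK_le; lra.
Qed.

(** * From the quadratic estimate to the radii *)

(** As [c < t], the hypothesis on [s] gives [s * (1 - t * d) <= t * d ^+ 2], that
    is, [s / d <= t * d / (1 - t * d)], and the right-hand side increases with
    [d].  The theorem uses this with [m] the boundary distance of the base point
    and [d] the smaller of the two boundary distances. *)
Lemma ratio_le_of_quadratic (R : realFieldType) (s c d t m : R) :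
  0 <= s -> 0 < d -> d <= m -> 0 <= t -> c < t -> t * m < 1 ->
  s <= c * d * (d + s) -> s / d <= t * m / (1 - t * m).
Proof.
move=> s_ge0 d_gt0 le_dm t_ge0 lt_ct tm_lt1 s_le.
have td_le : t * d <= t * m by exact: ler_wpM2l.
have ds : 0 < d * (d + s) by rewrite mulr_gt0// ltr_wpDr.
have s_le' : s * (1 - t * d) <= t * d * d.
  have : c * (d * (d + s)) <= t * (d * (d + s)) by rewrite ler_wpM2r// ltW.
  by lra.
apply: (@le_trans _ _ (t * d / (1 - t * d))).
  by rewrite ler_pdivrMr// mulrAC ler_pdivlMr//; lra.
rewrite ler_pdivrMr; last lra.
rewrite mulrAC ler_pdivlMr; last lra.
by lra.
Qed.

(** Allowing [v <= w] keeps the inequality strict at [v = 0], the case [x = y] of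
    the outer inclusion. *)
Lemma ln1D_lt (R : realType) (v w : R) : 0 <= v -> v <= w -> 0 < w ->
  ln (1 + v) < w.
Proof.
move=> v_ge0 le_vw w_gt0.
rewrite -[ltRHS]expRK ltr_ln ?posrE ?expR_gt0//; last lra.
apply: le_lt_trans (expR_gt1Dx _); last by rewrite gt_eqF.
by rewrite lerD2l.
Qed.

(** This is [ln (1 + z) <= z] at [z = - (v / (1 + v))], for which [1 + z] is the
    inverse of [1 + v]. *)
Lemma ln1D_ge (R : realType) (v : R) : 0 <= v -> v / (1 + v) <= ln (1 + v).
Proof.
move=> v_ge0; have v1 : 0 < 1 + v by lra.
have : ln (1 + - (v / (1 + v))) <= - (v / (1 + v)).
  apply: le_ln1Dx; rewrite ltrN2 ltr_pdivrMr//; lra.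
have -> : 1 + - (v / (1 + v)) = (1 + v)^-1 by field; lra.
by rewrite lnV ?posrE// lerN2.
Qed.

(** At [v = u / (1 + u)], the lower bound [v / (1 + v)] of [ln (1 + v)] equals
    [u / (1 + 2 * u)]. *)
Lemma radius_ratio_bounds (R : realType) (u : R) : 0 < u -> u < 1 ->
  (1 + u) / (1 - u) <= u / (1 - u) / ln (1 + u / (1 + u)) <=
  (1 + 2 * u) / (1 - u).
Proof.
move=> u_gt0 u_lt1.
have u1 : 0 < 1 + u by lra.
have u1' : 0 < 1 - u by lra.
set v := u / (1 + u).
have v_gt0 : 0 < v by rewrite divr_gt0.
have ln_le : ln (1 + v) <= v by apply: le_ln1Dx; lra.
have ln_ge : u / (1 + 2 * u) <= ln (1 + v).
  apply: le_trans (ln1D_ge _ _ (ltW v_gt0)).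
  by rewrite le_eqVlt; apply/orP; left; apply/eqP; rewrite /v; field; lra.
have lnv_gt0 : 0 < ln (1 + v) by apply: ln_gt0; lra.
rewrite mulrAC !ler_pM2r ?invr_gt0//.
rewrite ler_pdivlMr// ler_pdivrMr//; apply/andP; split.
  by rewrite mulrC -ler_pdivlMr.
by rewrite mulrC -ler_pdivrMr//; lra.
Qed.

Lemma radius_ratio_cvg (R : realType) (d : R) : 0 < d ->
  (t * d / (1 - t * d)) / ln (1 + t * d / (1 + t * d)) @[t --> 0^'+] --> (1 : R).
Proof.
move=> d_gt0.
have lim (k : R) : (1 + k * (t * d)) / (1 - t * d) @[t --> 0^'+] --> (1 : R).
  apply: cvg_at_right_filter.
  suff : (1 + k * (t * d)) / (1 - t * d) @[t --> 0] -->
      (1 + k * (0 * d)) / (1 - 0 * d).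
    by rewrite mul0r mulr0 addr0 subr0 divr1.
  apply: cvgM.
    apply: cvgD; first exact: cvg_cst.
    by apply: cvgM; [exact: cvg_cst|apply: cvgM; [exact: cvg_id|exact: cvg_cst]].
  apply: cvgV; first by rewrite mul0r subr0 oner_eq0.
  apply: cvgB; first exact: cvg_cst.
  by apply: cvgM; [exact: cvg_id|exact: cvg_cst].
apply: (squeeze_cvgr _ (lim 1) (lim 2)).
near=> t; rewrite mul1r; apply: radius_ratio_bounds.
  by rewrite mulr_gt0.
rewrite -ltr_pdivlMr// div1r.
near: t; apply: nbhs_right_lt; by rewrite invr_gt0.
Unshelve. all: by end_near. Qed.

Theorem theorem5p3 (R : realType) (n : nat) (D : set 'rV[R]_n) (x : 'rV[R]_n)
    (n_ge2 : (2 <= n)%N) (domD : domain D) (D_proper : D `<` setT)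
    (Dx : D x) :
  let rin := fun t : R => ln (1 + t * bdist D x / (1 + t * bdist D x)) in
  let rout := fun t : R => t * bdist D x / (1 - t * bdist D x) in
  (forall t : R, 0 < t -> 0 < 1 - t * bdist D x ->
     distance_ratio_ball D x (rin t) `<=` cassinian_ball D x t /\
     cassinian_ball D x t `<=` distance_ratio_ball D x (rout t)) /\
  rout t / rin t @[t --> 0^'+] --> (1 : R).
Proof.
case: domD => D_nonempty D_open _.
have d_gt0 z : D z -> 0 < bdist D z by exact: bdist_gt0.
have dx := d_gt0 _ Dx.
have bd := boundary_nonempty _ _ _ D_open D_nonempty D_proper.
move=> rin rout; split; last exact: radius_ratio_cvg.
move=> t t_gt0 td_lt1; set d := bdist D x in dx td_lt1 *.
split=> y [Dy lt_y]; split=> //; have dy := d_gt0 _ Dy.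
- apply: le_lt_trans (cassinian_le _ _ _ _ _ bd dx dy) _.
  set e := bdist D y in lt_y dy *; set s := enorm (x - y) in lt_y *.
  have s_ge0 : 0 <= s := enorm_ge0 _ _ _.
  move: lt_y; rewrite /distance_ratio /rin -/d -/e -/s.
  have m_gt0 : 0 < Num.min d e by rewrite lt_min dx.
  have td_gt0 : 0 < t * d by rewrite mulr_gt0.
  have td1 : 0 < 1 + t * d by lra.
  rewrite ltr_ln ?posrE; last 2 first.
    by rewrite ltr_pwDl// divr_ge0// ltW.
    by rewrite ltr_wpDr// divr_ge0// ltW.
  rewrite ltrD2l => lt_sm.
  have -> : d * e = Num.min d e * Num.max d e.
    by rewrite minEle maxEle; case: ifP => // _; rewrite mulrC.
  have le_dM : d <= Num.max d e by rewrite le_max lexx.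
  have M_gt0 : 0 < Num.max d e by exact: lt_le_trans le_dM.
  rewrite invfM mulrA ltr_pdivrMr//.
  apply: (lt_le_trans lt_sm); rewrite ler_pdivrMr//.
  have : t * d <= t * Num.max d e by rewrite ler_wpM2l// ltW.
  have : 0 <= t * d * (t * Num.max d e) by rewrite !mulr_ge0// ltW.
  by lra.
- rewrite /distance_ratio -/d; set s := enorm (x - y).
  have s_ge0 : 0 <= s := enorm_ge0 _ _ _.
  have m_gt0 : 0 < Num.min d (bdist D y) by rewrite lt_min dx.
  apply: ln1D_lt; first by rewrite divr_ge0// ltW.
    apply: (ratio_le_of_quadratic _ _ (cassinian D x y)) => //.
    + by rewrite ge_min lexx.
    + exact: ltW.
    + lra.
    + rewrite minEle; case: ifP => _; first exact: enorm_le_cassinian.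
      by rewrite cassinianC /s enormB; exact: enorm_le_cassinian.
  by rewrite /rout -/d divr_gt0// mulr_gt0.
Qed.
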